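(* Let $X$ be a US-space. There are a complete Boolean algebra $\mathbb{B}_X$ and an injective map $$j:X\longrightarrow G_{\mathbb{B}_X},\qquad j(x)=(b_x,\neg b_x),$$ (namely, $\mathbb{B}_X=\operatorname{RO}(P_X)$ and the elements $b_x$ defined in the context) which preserves convergent sequences, that is, $s_n\to s_\infty$ in $X$ implies $j(s_n)\to j(s_\infty)$ in $G_{\mathbb{B}_X}$. If $X$ is sequential, then $j$ is continuous. If $X$ is both sequential and compact, then $j$ is a topological embedding.
   Context: A US-space is a topological space in which each convergent sequence has a unique limit. A space is sequential if a subset $A$ is closed if and only if $A$ contains all limits of all convergent sequences of points of $A$. Compactness means that every open cover has a finite subcover (no separation axiom is assumed). Scott topology and complement graph: a subset $U$ of a poset $P$ is Scott open if it is an upper set and, whenever a directed (nonempty) set $D\subseteq P$ has a supremum with $\bigvee D\in U$, one has $D\cap U\neq\varnothing$; $\Sigma P$ is $P$ with this topology. For a complete Boolean algebra $B$ with complement $\neg$, $B^2$ has the coordinatewise order and $G_B=\{(b,\neg b):b\in B\}\subseteq B^2$ carries the subspace topology inherited from $\Sigma B^2$. The poset $P_X$: let $X$ be a US-space and $\mathcal{S}(X)$ the set of convergent sequences $s=(s_n)_{n\in\mathbb{N}}$ in $X$; the unique limit of $s$ is denoted $s_\infty$. Consider pairs $p=(\Gamma_p,\varepsilon_p)$ where $\Gamma_p$ is a finite subset of $\mathcal{S}(X)\times\mathbb{N}$ and $\varepsilon_p:X\rightharpoonup\{0,1\}$ is a finite partial map. Let $\sim_p$ be the equivalence relation on $X$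 generated by $s_n\sim_p s_\infty$ for all $(s,N)\in\Gamma_p$ and $n\geq N$. The pair $p$ is admissible if $u\sim_p v$ and $u,v\in\operatorname{dom}(\varepsilon_p)$ imply $\varepsilon_p(u)=\varepsilon_p(v)$. $P_X$ is the set of all admissible pairs, ordered by $q\leq p$ iff $\Gamma_q\supseteq\Gamma_p$ and $\varepsilon_q\supseteq\varepsilon_p$. A $\sim_p$-class is colored if it meets $\operatorname{dom}(\varepsilon_p)$, and its color is then the common value of $\varepsilon_p$ on the points of the class in $\operatorname{dom}(\varepsilon_p)$. Regular-open completion: for a poset $P$, give $P$ the topology whose open sets are the lower sets. $\operatorname{RO}(P)$ is the complete Boolean algebra of regular open subsets ($U=\operatorname{int}\operatorname{cl}U$), ordered by inclusion; meet of $U,V$ is $U\cap V$, complement of $U$ is $\operatorname{int}(P\setminus U)$, and the join of $(U_i)_i$ is $\operatorname{int}\operatorname{cl}\bigcup_iU_i$. For $p\in P$ put $\rho(p)=\operatorname{int}\operatorname{cl}({\downarrow}p)$, where ${\downarrow}p=\{q\in P:q\leq p\}$. Put $\mathbb{B}_X=\operatorname{RO}(P_X)$. For $x\in X$ and $i\in\{0,1\}$ let $P(x,i)=\{p\in P_X:\text{the }\sim_p\text{-class of }x\text{ is colored with color }i\}$ and $b_x^i=\bigvee_{p\in P(x,i)}\rho(p)\in\mathbb{B}_X$. Put $b_x=b_x^1$. *)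

(* Defs.v *)
From HB Require Import structures.
From Stdlib Require Import Relation_Operators.
From mathcomp Require Import all_boot all_order finmap.
From mathcomp Require Import all_classical topology.

Set Implicit Arguments.
Unset Strict Implicit.
Unset Printing Implicit Defensive.
Import Order.TTheory.
Local Open Scope classical_set_scope.

Definition US_space (X : topologicalType) : Prop :=
  forall (s : nat -> X) (x y : X), s @ \oo --> x -> s @ \oo --> y -> x = y.

Definition sequential_space (X : topologicalType) : Prop :=
  forall A : set X, closed A <->
    (forall (s : nat -> X) (x : X),
       (forall n, A (s n)) -> s @ \oo --> x -> A x).

(* The third clause says that f is open onto its range, the latter carrying
   the subspace topology, i.e., f is a homeomorphism onto its image. *)
Definition topological_embedding (X Y : topologicalType) (f : X -> Y) : Prop :=
  [/\ injective f, continuous f &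
      forall U : set X, open U ->
        exists2 V : set Y, open V & f @` U = range f `&` V].

Definition complete_lattice d (L : porderType d) : Prop :=
  forall A : set L, exists x, isLub A x.

Definition directed d (P : porderType d) (D : set P) : Prop :=
  D !=set0 /\
  (forall x y, D x -> D y -> exists z, [/\ D z, (x <= z)%O & (y <= z)%O]).

Definition scott_open d (P : porderType d) (U : set P) : Prop :=
  (forall x y : P, (x <= y)%O -> U x -> U y) /\
  (forall (D : set P) (x : P),
     directed D -> isLub D x -> U x -> D `&` U !=set0).

Definition scott d (P : porderType d) : Type := P.

Section ScottTopology.
Context d (P : porderType d).

HB.instance Definition _ := Order.POrder.on (scott P).

Let opT : scott_open [set: P].
Proof. by split=> // D x [[y Dy] _] _ _; exists y. Qed.

Let opI : setI_closed (@scott_open d P).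
Proof.
move=> U V [Uup Usup] [Vup Vsup]; split=> [x y xy [Ux Vx]|D x Dd Dx [Ux Vx]].
  by split; [apply: Uup Ux|apply: Vup Vx].
have [u [Du Uu]] := Usup _ _ Dd Dx Ux.
have [v [Dv Vv]] := Vsup _ _ Dd Dx Vx.
have [z [Dz uz vz]] := Dd.2 _ _ Du Dv.
by exists z; split=> //; split; [apply: Uup Uu|apply: Vup Vv].
Qed.

Let op_bigU (I : Type) (f : I -> set P) :
  (forall i, scott_open (f i)) -> scott_open (\bigcup_i f i).
Proof.
move=> fop; split=> [x y xy [i _ fx]|D x Dd Dx [i _ fx]].
  by exists i => //; apply: (fop i).1 fx.
by have [y [Dy fy]] := (fop i).2 _ _ Dd Dx fx; exists y; split=> //; exists i.
Qed.

HB.instance Definition _ :=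
  isOpenTopological.Build (scott P) opT opI op_bigU.

End ScottTopology.

Definition compl_graph d (B : ctbDistrLatticeType d) : set (scott (B *p B)) :=
  range (fun b : B => (b, (~` b)%O) : scott (B *p B)).
Arguments compl_graph {d} B.

Definition lower_open d (P : porderType d) (U : set P) : Prop :=
  forall p q : P, (q <= p)%O -> U p -> U q.

(* P with the topology whose open sets are the lower sets *)
Definition lower d (P : porderType d) : Type := P.

Section LowerTopology.
Context d (P : porderType d).

HB.instance Definition _ := Order.POrder.on (lower P).

Let opT : lower_open [set: P]. Proof. by []. Qed.

Let opI : setI_closed (@lower_open d P).
Proof.
by move=> U V Ul Vl p q qp [Up Vp]; split; [apply: Ul Up|apply: Vl Vp].
Qed.

Let op_bigU (I : Type) (f : I -> set P) :
  (forall i, lower_open (f i)) -> lower_open (\bigcup_i f i).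
Proof. by move=> fop p q qp [i _ fp]; exists i => //; apply: (fop i) fp. Qed.

HB.instance Definition _ :=
  isOpenTopological.Build (lower P) opT opI op_bigU.

End LowerTopology.

Record RO (T : topologicalType) := MkRO {
  RO_set :> set T;
  _ : `[< regopen RO_set >] }.

HB.instance Definition _ T := [isSub for @RO_set T].
HB.instance Definition _ T := [Choice of RO T by <:].

Fact RO_display : Order.disp_t. Proof. exact: (Order.Disp tt tt). Qed.

Section RegularOpenAlgebra.
Context {T : topologicalType}.
Implicit Types (A B : set T) (U V W : RO T).

Lemma RO_regopen U : regopen U.
Proof. by case: U => A /= /asboolP. Qed.

Lemma RO_open U : open (U : set T).
Proof. by rewrite -(RO_regopen U); exact: open_interior. Qed.

Lemma RO_inj U V : U = V :> set T -> U = V.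
Proof. exact: val_inj. Qed.

Fact ic_subproof A : `[< regopen (closure A)° >].
Proof. by apply/asboolP/interior_closed_regopen/closed_closure. Qed.

Definition RO_ic A : RO T := MkRO (ic_subproof A).

Lemma ic_sub A U : A `<=` U -> RO_ic A `<=` U.
Proof. by move=> AU; rewrite -(RO_regopen U); exact/interiorS/closureS. Qed.

Lemma sub_ic A : open A -> A `<=` RO_ic A.
Proof. by move=> oA; rewrite /= -open_subsetE//; exact: subset_closure. Qed.

Lemma ic_setI A B : open B -> RO_ic A `&` B `<=` RO_ic (A `&` B).
Proof.
move=> oB /=; rewrite -open_subsetE; last exact/openI/oB/open_interior.
move=> x [/interior_subset clAx Bx] N Nx.
have [|y [Ay [Ny By]]] := clAx (N `&` B); last by exists y.
by apply: filterI => //; exact: open_nbhs_nbhs.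
Qed.

Definition RO_le U V : bool := `[< (U : set T) `<=` V >].

Fact RO_le_refl : reflexive RO_le. Proof. by move=> U; apply/asboolP. Qed.

Fact RO_le_anti : antisymmetric RO_le.
Proof. by move=> U V /andP[/asboolP ? /asboolP ?]; apply/RO_inj/seteqP. Qed.

Fact RO_le_trans : transitive RO_le.
Proof.
by move=> V U W /asboolP UV /asboolP VW; apply/asboolP; exact: subset_trans VW.
Qed.

HB.instance Definition _ := Order.Le_isPOrder.Build RO_display (RO T)
  RO_le_refl RO_le_anti RO_le_trans.

Lemma RO_leP U V : reflect ((U : set T) `<=` V) (U <= V)%O.
Proof. exact: asboolP. Qed.

Fact meet_subproof U V : `[< regopen ((U : set T) `&` V) >].
Proof.
apply/asboolP/seteqP; split; last first.
  by apply: sub_ic; apply: openI; exact: RO_open.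
by move=> x Wx; split; move: x Wx;
  [apply: (@ic_sub _ U)|apply: (@ic_sub _ V)] => x [].
Qed.

Definition RO_meet U V : RO T := MkRO (meet_subproof U V).

Definition RO_join U V : RO T := RO_ic ((U : set T) `|` V).

Fact RO_meetP U V W : (U <= RO_meet V W)%O = (U <= V)%O && (U <= W)%O.
Proof.
apply/RO_leP/andP => [UVW|[/RO_leP UV /RO_leP UW] x Ux].
  by split; apply/RO_leP => x /UVW[].
by split; [exact: UV|exact: UW].
Qed.

Fact RO_joinP U V W : (RO_join U V <= W)%O = (U <= W)%O && (V <= W)%O.
Proof.
apply/RO_leP/andP => [UVW|[/RO_leP UW /RO_leP VW]]; last first.
  by apply: ic_sub => x [/UW|/VW].
by split; apply/RO_leP => x Ux; apply: UVW; apply: sub_ic;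
  [exact/openU/RO_open/RO_open|left|exact/openU/RO_open/RO_open|right].
Qed.

HB.instance Definition _ :=
  Order.POrder_MeetJoin_isLattice.Build RO_display (RO T) RO_meetP RO_joinP.

Fact RO_meetUl :
  @left_distributive (RO T) (RO T) Order.meet Order.join.
Proof.
move=> U V W; apply/le_anti/andP; split; last first.
  by rewrite lexI !leUx leIr (le_trans (leIl _ _) (leUl _ _)) leIr
             (le_trans (leIl _ _) (leUr _ _)).
apply/RO_leP => x /(@ic_setI _ _ (RO_open W)); apply: ic_sub.
move=> y [[Uy|Vy] Wy]; apply: sub_ic;
  by [exact/openU/RO_open/RO_open|left|right].
Qed.

HB.instance Definition _ :=
  Order.Lattice_Meet_isDistrLattice.Build RO_display (RO T) RO_meetUl.

Fact bot_subproof : `[< regopen (@set0 T) >].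
Proof. by apply/asboolP; rewrite /regopen closure0 interior0. Qed.

Fact top_subproof : `[< regopen [set: T] >].
Proof. by apply/asboolP; rewrite /regopen closureT interiorT. Qed.

Definition RO_bot : RO T := MkRO bot_subproof.
Definition RO_top : RO T := MkRO top_subproof.

Fact RO_bot_le U : (RO_bot <= U)%O. Proof. by apply/RO_leP. Qed.
Fact RO_le_top U : (U <= RO_top)%O. Proof. by apply/RO_leP. Qed.

HB.instance Definition _ := Order.hasBottom.Build RO_display (RO T) RO_bot_le.
HB.instance Definition _ := Order.hasTop.Build RO_display (RO T) RO_le_top.

Fact compl_subproof U : `[< regopen (~` (U : set T))° >].
Proof. by apply/asboolP/interior_closed_regopen/open_closedC/RO_open. Qed.

Definition RO_compl U : RO T := MkRO (compl_subproof U).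

Fact RO_joinxC U : (U `|` RO_compl U)%O = \top%O.
Proof.
apply/RO_inj/seteqP; split=> // x _ /=; suff -> :
    closure ((U : set T) `|` (~` (U : set T))°) = setT by rewrite interiorT.
apply/seteqP; split=> // y _; rewrite closureU interiorC.
by case: (pselect (closure U y)) => ?; [left|right; exact: subset_closure].
Qed.

Fact RO_meetxC U : (U `&` RO_compl U)%O = \bot%O.
Proof.
by apply/RO_inj/seteqP; split=> // x [/= Ux /interior_subset /(_ Ux)].
Qed.

HB.instance Definition _ :=
  Order.TBDistrLattice_hasComplement.Build RO_display (RO T)
    RO_joinxC RO_meetxC.

Definition RO_sup (F : set (RO T)) : RO T :=
  RO_ic (\bigcup_(U in F) (U : set T)).

Lemma RO_supP (F : set (RO T)) : isLub F (RO_sup F).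
Proof.
split=> [U FU|V ubV]; apply/RO_leP.
  move=> x Ux; apply: sub_ic; last by exists U.
  by apply: bigcup_open => V _; exact: RO_open.
by apply: ic_sub => x [U FU Ux]; have /RO_leP := ubV _ FU; apply.
Qed.

End RegularOpenAlgebra.

Notation ROP P := (RO (lower P)).

Definition rho d (P : porderType d) (p : P) : ROP P :=
  RO_ic [set q : lower P | (q <= p)%O].

Definition convseq (X : topologicalType) :=
  {s : nat -> X | s \in [set s : nat -> X | exists x : X, s @ \oo --> x]}.

(* By choice; in a US-space this is the unique limit of s. *)
Definition limit (X : topologicalType) (s : convseq X) : X :=
  projT1 (cid (set_mem (valP s))).

Section Conditions.
Variable X : topologicalType.

(* The pairs (Gamma_p, epsilon_p), before admissibility is imposed. *)
Definition precond : Type := ({fset convseq X * nat} * {fmap X -> bool})%type.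

Definition Gam (p : precond) : {fset convseq X * nat} := p.1.
Definition eps (p : precond) : {fmap X -> bool} := p.2.

Definition gen_step (p : precond) (u v : X) : Prop :=
  exists s N n, [/\ (s, N) \in Gam p, (N <= n)%N, u = val s n & v = limit s].

Definition peq (p : precond) : X -> X -> Prop :=
  clos_refl_sym_trans X (gen_step p).

Definition admissible (p : precond) : Prop :=
  forall u v, peq p u v -> u \in domf (eps p) -> v \in domf (eps p) ->
    (eps p).[? u]%fmap = (eps p).[? v]%fmap.

Record cond := MkCond {
  cond_val :> precond;
  _ : `[< admissible cond_val >] }.

HB.instance Definition _ := [isSub for cond_val].
HB.instance Definition _ := [Choice of cond by <:].

Definition cond_le (q p : cond) : bool :=
  `[< {subset Gam p <= Gam q} /\
      (forall u i,
         (eps p).[? u]%fmap = Some i -> (eps q).[? u]%fmap = Some i) >].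

Fact cond_le_refl : reflexive cond_le.
Proof. by move=> p; apply/asboolP; split. Qed.

Fact cond_le_anti : antisymmetric cond_le.
Proof.
move=> p q /andP[/asboolP[qp1 qp2] /asboolP[pq1 pq2]]; apply: val_inj => /=.
have E1 : Gam p = Gam q by apply/fsetP => z; apply/idP/idP => [/pq1|/qp1].
have E2 : eps p = eps q.
  apply/fmapP => u; case E: ((eps p).[? u])%fmap => [i|].
    by rewrite (pq2 _ _ E).
  by case F: ((eps q).[? u])%fmap => [i|] //; rewrite -E (qp2 _ _ F).
by rewrite [LHS]surjective_pairing [RHS]surjective_pairing; congr pair.
Qed.

Fact cond_le_trans : transitive cond_le.
Proof.
move=> q p r /asboolP[qp1 qp2] /asboolP[rq1 rq2]; apply/asboolP.
by split=> [z /rq1 /qp1|u i /rq2 /qp2].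
Qed.

Fact cond_display : Order.disp_t. Proof. exact: (Order.Disp tt tt). Qed.

HB.instance Definition _ := Order.Le_isPOrder.Build cond_display cond
  cond_le_refl cond_le_anti cond_le_trans.

(* The ~_p-class of x is colored, with color i. *)
Definition colored (p : cond) (x : X) (i : bool) : Prop :=
  exists2 u, peq p x u & (eps p).[? u]%fmap = Some i.

Definition BX : Type := ROP cond.

HB.instance Definition _ := Order.CTBDistrLattice.on BX.

Definition bcolor (i : bool) (x : X) : BX :=
  RO_sup [set rho p | p in [set p : cond | colored p x i]].

Definition b_elt (x : X) : BX := bcolor true x.

Fact jmap_subproof (x : X) :
  compl_graph BX ((b_elt x, (~` b_elt x)%O) : scott (BX *p BX)).
Proof. by exists (b_elt x). Qed.

Definition jmap (x : X) : compl_graph BX :=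
  exist (fun z => z \in compl_graph BX) _ (mem_set (jmap_subproof x)).

End Conditions.

(* Main.v *)
(* Below a condition containing (s, N), the points s_n for n >= N and the limit
   of s have the same color, so b_{s_n} and b_{s_infty} agree below the join
   e_N of these conditions. In a US-space the color classes of a condition are
   sequentially closed, hence every condition can be extended by (s, N) for
   large N: the increasing sequence e_N has join 1. So (b, ~b), for
   b = b_{s_infty}, is the directed join of the truncations
   (b & e_N, ~b & e_N), and the N-th of them is below j(s_n) for all n >= N:
   j preserves convergent sequences. The same truncation shows
   that {x | d <= j(x)} is sequentially closed. If X is sequential and compact
   and A is closed in X, then the sets {x in A | d <= j(x)} are therefore
   compact, so that the lower set generated by j(A) is Scott closed; as G_B is
   an antichain, it meets j(X) in j(A) only. *)
Require Import Defs.
From Stdlib Require Import Relation_Operators.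
From mathcomp Require Import all_boot all_order finmap.
From mathcomp Require Import all_classical topology.
Import Order.TTheory.
Local Open Scope classical_set_scope.

Set Implicit Arguments.
Unset Strict Implicit.
Unset Printing Implicit Defensive.

(** * Regular open sets of the lower topology *)

Section LowerRegularOpen.
Context d (P : porderType d).
Implicit Types (p q r : P) (A : set (lower P)) (U V : ROP P).

Lemma lower_nbhsE p A : nbhs (p : lower P) A <-> [set q | (q <= p)%O] `<=` A.
Proof.
split=> [|pA].
  by rewrite nbhsE => -[B [oB Bp] BA] q qp; apply: BA; exact: oB qp Bp.
rewrite nbhsE; exists [set q : lower P | (q <= p)%O] => //.
by split=> /=; [move=> q r rq /(le_trans rq)|].
Qed.

Lemma RO_icE A p : (RO_ic A : set (lower P)) p <->
  forall q, (q <= p)%O -> exists2 r, (r <= q)%O & A r.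
Proof.
split=> [/lower_nbhsE Ap q /Ap/(_ [set r | (r <= q)%O])[|r []]|pA].
- exact/lower_nbhsE.
- by exists r.
apply/lower_nbhsE => q /pA[r rq Ar] B /lower_nbhsE qB.
by exists r; split=> //; exact: qB.
Qed.

Lemma RO_down U p q :
  (q <= p)%O -> (U : set (lower P)) p -> (U : set (lower P)) q.
Proof. by move=> qp Up; exact: (@RO_open _ U) qp Up. Qed.

(** Regularity enters here: membership may be tested on a dense set of extensions, so any condition
    can first be extended by data useful for the test. *)
Lemma RO_dense U p :
  (forall q, (q <= p)%O ->
     exists2 r, (r <= q)%O & (U : set (lower P)) r) ->
  (U : set (lower P)) p.
Proof. by move=> pU; rewrite -(RO_regopen U); apply/RO_icE. Qed.

Lemma RO_complE U p :
  ((~` U)%O : set (lower P)) p <->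
  forall q, (q <= p)%O -> ~ (U : set (lower P)) q.
Proof. exact: lower_nbhsE. Qed.

Lemma rho_self p : (rho p : set (lower P)) p.
Proof. by apply/RO_icE => q qp; exists q. Qed.

End LowerRegularOpen.

Lemma directed_fset d (P : porderType d) (D : set P) (F : {fset P}) :
  directed D -> {subset F <= D} ->
  exists2 z, D z & forall y, y \in F -> (y <= z)%O.
Proof.
move=> [[z0 Dz0] Ddir]; elim/finSet_rect: F => F IH FD.
have [->|[y yF]] := fset_0Vmem F; first by exists z0 => // y; rewrite in_fset0.
have /IH[|z Dz zF] := fproperD1 yF.
  by move=> w; rewrite in_fsetD1 => /andP[_ /FD].
have [w [Dw zw yw]] := Ddir z y Dz (set_mem (FD _ yF)).
exists w => // v vF; have [->//|vy] := eqVneq v y.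
by apply: le_trans zw; apply: zF; rewrite in_fsetD1 vy.
Qed.

(** * Convergent sequences in a US-space *)

Section Sequences.
Variable X : topologicalType.
Hypothesis hX : US_space X.
Implicit Types (s t : nat -> X) (x y v : X).

Lemma cvg_subseq s x (f : nat -> nat) :
  s @ \oo --> x -> (forall k, (k <= f k)%N) -> (s \o f) @ \oo --> x.
Proof.
move=> sx fk; apply: cvg_comp sx; apply/cvgnyPge => A.
by near do apply: leq_trans (fk _); exact: nbhs_infty_ge.
Unshelve. all: by end_near. Qed.

(** Common values at arbitrarily late indices form one sequence that is a reindexing of both [s] and
    [t], so it converges to both limits. *)
Lemma US_limit_eq s t x y : s @ \oo --> x -> t @ \oo --> y ->
  (forall k, exists n m, [/\ (k <= n)%N, (k <= m)%N & s n = t m]) -> x = y.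
Proof.
move=> sx ty /choice[f /choice[g fg]].
have sf : (s \o f) @ \oo --> x by apply: cvg_subseq sx _ => k; have [] := fg k.
apply: hX sf _; rewrite (_ : s \o f = t \o g).
  by apply: cvg_subseq ty _ => k; have [] := fg k.
by apply/funext => k; have [] := fg k.
Qed.

Lemma US_near_neq s x v : s @ \oo --> x -> x <> v ->
  \forall n \near \oo, s n <> v.
Proof.
move=> sx xv; apply: contrapT => freq; apply: xv.
apply: (US_limit_eq sx (@cvg_cst _ v nat \oo _)) => k.
apply: contrapT => nk; apply: freq; exists k => // n /= kn snv.
by apply: nk; exists n, k.
Qed.

Lemma US_near_notin_tail s t x y N : s @ \oo --> x -> t @ \oo --> y -> x <> y ->
  (forall m, (N <= m)%N -> x <> t m) ->
  \forall n \near \oo, forall m, (N <= m)%N -> s n <> t m.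
Proof.
move=> sx ty xy xt; apply: contrapT => freq; apply: xy.
apply: (US_limit_eq sx ty) => k.
(* The finitely many terms [t m] with [m < k] are avoided eventually, so a late coincidence must
   occur at an index [m >= k]. *)
have near_lt : \forall n \near \oo, forall m : 'I_k, (N <= m)%N -> s n <> t m.
  apply: filter_forall => m; have [Nm|_] := leqP N m; last exact: nearW.
  by apply: filterS (US_near_neq sx (xt m Nm)) => n.
apply: contrapT => nk; apply: freq.
near=> n => m Nm stm; have [mk|km] := ltnP m k.
  have : forall m : 'I_k, (N <= m)%N -> s n <> t m by near: n.
  by move=> /(_ (Ordinal mk)); exact.
apply: nk; exists n, m; split=> //; near: n; exact: nbhs_infty_ge.
Unshelve. all: by end_near. Qed.

End Sequences.

(** * Colorings and extensions of conditions *)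

Section Coloring.
Variable X : topologicalType.
Hypothesis hX : US_space X.
Implicit Types (p q r : cond X) (s : convseq X) (x u v : X) (i : bool).

Lemma cond_leP q p : reflect ({subset Gam p <= Gam q} /\
  (forall u i, (eps p).[? u]%fmap = Some i -> (eps q).[? u]%fmap = Some i))
  (q <= p)%O.
Proof. exact: asboolP. Qed.

Lemma limit_cvg s : val s @ \oo --> limit s.
Proof. exact: projT2 (cid (set_mem (valP s))). Qed.

Lemma colored_peq p u v i : peq p u v -> colored p v i -> colored p u i.
Proof. by move=> uv [w vw wi]; exists w => //; exact: rst_trans vw. Qed.

Lemma peq_sym p u v : peq p u v -> peq p v u.
Proof. exact: rst_sym. Qed.

Lemma colored_tail p s N n i : (s, N) \in Gam p -> (N <= n)%N ->
  colored p (val s n) i <-> colored p (limit s) i.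
Proof.
move=> sN Nn; have E : peq p (val s n) (limit s).
  by apply: rst_step; exists s, N, n.
by split; apply: colored_peq => //; exact: peq_sym.
Qed.

Lemma colored_eps p u i : (eps p).[? u]%fmap = Some i -> colored p u i.
Proof. by exists u => //; exact: rst_refl. Qed.

Lemma colored_down p q x i : (q <= p)%O -> colored p x i -> colored q x i.
Proof.
move=> /cond_leP[Gpq epq] [u xu /epq ui]; exists u => //.
elim: xu => [a b [s [N [n [/Gpq sN Nn -> ->]]]]|a|a b _|a b c _ + _].
- by apply: rst_step; exists s, N, n.
- exact: rst_refl.
- exact: rst_sym.
- exact: rst_trans.
Qed.

Lemma colored_unique p x i j : colored p x i -> colored p x j -> i = j.
Proof.
case: p => p /[dup] /asboolP adm ap [u xu ui] [v xv vj].
have domE w k : ((eps p).[? w])%fmap = Some k -> w \in domf (eps p).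
  by move=> wk; rewrite -fndSome wk.
have uv : peq p u v := rst_trans _ _ _ _ _ (peq_sym xu) xv.
have := adm u v uv (domE _ _ ui) (domE _ _ vj).
by rewrite ui vj => -[].
Qed.

(** A total coloring that respects the generating steps is constant on the classes they generate;
    exhibiting one avoids computing these classes. *)
Lemma admissible_coloring (p : precond X) (c : X -> bool) :
  (forall u i, (eps p).[? u]%fmap = Some i -> c u = i) ->
  (forall s N n, (s, N) \in Gam p -> (N <= n)%N -> c (val s n) = c (limit s)) ->
  admissible p.
Proof.
move=> ce cG u v uv ud vd; rewrite (in_fnd ud) (in_fnd vd).
rewrite -(ce _ _ (in_fnd ud)) -(ce _ _ (in_fnd vd)); congr Some.
elim: uv {ud vd} => [a b [s [N [n [sN Nn -> ->]]]]|//|//|a b e _ -> _ -> //].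
exact: cG sN Nn.
Qed.

(* The total coloring extending that of [p] by [d] on the uncolored classes. *)
Definition completion p (d : bool) u : bool :=
  if `[< colored p u (~~ d) >] then ~~ d else d.

Lemma completion_colored p d u i : colored p u i -> completion p d u = i.
Proof.
rewrite /completion => ui; case: asboolP => [/colored_unique|ud]; first exact.
by case: (eqVneq d i) => // di; case: ud; move: ui di; case: d; case: i.
Qed.

Lemma completion_uncolored p d u : ~ colored p u (~~ d) -> completion p d u = d.
Proof. by rewrite /completion => ud; case: asboolP. Qed.

Lemma completion_tail p d s N n : (s, N) \in Gam p -> (N <= n)%N ->
  completion p d (val s n) = completion p d (limit s).
Proof.
move=> sN Nn; rewrite /completion.
congr (if _ then _ else _); apply: asbool_equiv_eq.
exact: colored_tail sN Nn.
Qed.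

Lemma color_extend p x i : ~ colored p x (~~ i) ->
  exists2 q, (q <= p)%O & colored q x i.
Proof.
move=> xi; pose q0 : precond X := (Gam p, (eps p).[x <- i]%fmap).
have adm : admissible q0.
  apply: (@admissible_coloring _ (completion p i)) => [u j|s N n].
    rewrite /q0 /= fnd_set; case: eqP => [-> [<-]|_ /colored_eps].
      exact: completion_uncolored.
    exact: completion_colored.
  exact: completion_tail.
exists (MkCond (asboolT adm)); last first.
  by apply: colored_eps; rewrite /= fnd_set eqxx.
(* If [x] was already in the domain, its old color is [i], so overwriting it changes nothing. *)
apply/cond_leP; split=> //= u j uj; rewrite fnd_set; case: eqP => // ux.
congr Some; rewrite -(completion_colored i (colored_eps uj)) ux.
by rewrite completion_uncolored.
Qed.

Definition in_tail p u := exists s N, (s, N) \in Gam p /\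
  (u = limit s \/ exists2 n, (N <= n)%N & u = val s n).

Lemma peq_in_tail p u v : peq p u v -> u = v \/ in_tail p u /\ in_tail p v.
Proof.
elim=> [a b [s [N [n [sN Nn -> ->]]]]|a|a b _|a b c _ + _].
- by right; split; exists s, N; split=> //; [right; exists n|left].
- by left.
- by move=> [->|[]]; [left|right].
- by move=> [->|[ta tb]] [<-|[tb' tc]]; by [left|right].
Qed.

(* A color class is a finite union of points and of tails of convergent
   sequences together with their limits. *)
Lemma colored_near (s : nat -> X) x p i : s @ \oo --> x -> ~ colored p x i ->
  \forall n \near \oo, ~ colored p (s n) i.
Proof.
move=> sx xi.
have near_dom : \forall n \near \oo, forall v, v \in domf (eps p) ->
    (eps p).[? v]%fmap = Some i -> s n <> v.
  apply: filter_bigI => v _.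
  have [vi|vi] := pselect ((eps p).[? v]%fmap = Some i); last first.
    by apply: (@filterE _ \oo) => n /vi.
  have xv : x <> v by move=> E; apply: xi; rewrite E; exact: colored_eps.
  by apply: filterS (US_near_neq hX sx xv) => n.
have near_Gam : \forall n \near \oo, forall z, z \in Gam p ->
    colored p (limit z.1) i -> s n <> limit z.1 /\
    forall m, (z.2 <= m)%N -> s n <> val z.1 m.
  apply: filter_bigI => -[t N] tN.
  have [ti|ti] := pselect (colored p (limit t) i); last first.
    by apply: (@filterE _ \oo) => n /ti.
  have xt : x <> limit t by move=> E; apply: xi; rewrite E.
  apply: filterS2 (US_near_neq hX sx xt)
    (US_near_notin_tail hX (N := N) sx (limit_cvg (s := t)) xt _)
    => [n //|m Nm E].
  by apply: xi; rewrite E; apply/(colored_tail _ tN Nm).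
apply: filterS2 near_dom near_Gam => n ndom nGam.
(* If [s n] had color [i], it would be a point of the domain with that color or lie in a tail, limit
   included, whose limit has that color; both are excluded. *)
move=> [v nv vi]; have vd : v \in domf (eps p) by rewrite -fndSome vi.
have [E|[[t [N [tN tail]]] _]] := peq_in_tail nv; first exact: (ndom v).
have ni : colored p (s n) i by exists v.
have ti : colored p (limit t) i.
  by case: tail => [<-//|[m Nm E]]; apply/(colored_tail _ tN Nm); rewrite -E.
have [nl nt] := nGam (t, N) tN ti.
by case: tail => [//|[m Nm]]; exact: nt.
Qed.

Lemma sequence_extend p s : exists N, exists2 q, (q <= p)%O & (s, N) \in Gam q.
Proof.
(* The default color [d] is chosen so that the limit does not have the opposite color. By
   [colored_near] neither do late terms, so the completion takes the value [d] on the new tail and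
   at its limit. *)
pose d := `[< colored p (limit s) true >].
have sd : ~ colored p (limit s) (~~ d).
  rewrite /d; case: asboolP => [s1 /(colored_unique s1)//|//].
have [N _ sN] := colored_near (limit_cvg (s := s)) sd; exists N.
pose q0 : precond X := ((s, N) |` Gam p, eps p)%fset.
have adm : admissible q0.
  apply: (@admissible_coloring _ (completion p d)) => [u i|t M n].
    by move=> /colored_eps; exact: completion_colored.
  rewrite in_fset1U => /orP[/eqP[-> ->] Nn|]; last exact: completion_tail.
  by rewrite !completion_uncolored//; exact: sN.
exists (MkCond (asboolT adm)); last by rewrite in_fset1U eqxx.
by apply/cond_leP; split=> //= z zp; rewrite in_fset1U zp orbT.
Qed.

(** * Boolean values of tails and colors *)

(* The Boolean value of "some [(s, M)] with [M <= N] has entered Gamma". *)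
Definition tail_value s N : BX X :=
  RO_ic [set p : lower (cond X) | exists2 M, (M <= N)%N & (s, M) \in Gam p].

Lemma tail_value_ge s M N p : (s, M) \in Gam p -> (M <= N)%N ->
  (tail_value s N : set (lower (cond X))) p.
Proof.
move=> sM MN; apply/RO_icE => q /cond_leP[pq _].
by exists q => //; exists M => //; exact: pq.
Qed.

Lemma tail_value_le s M N : (M <= N)%N -> (tail_value s M <= tail_value s N)%O.
Proof.
move=> MN; apply/RO_leP => p /RO_icE pM; apply/RO_icE => q /pM[r rq [K KM sK]].
by exists r => //; exists K => //; exact: leq_trans MN.
Qed.

Lemma bcolorE i x p : (bcolor i x : set (lower (cond X))) p <->
  forall q, (q <= p)%O -> exists2 r, (r <= q)%O & colored r x i.
Proof.
split=> [/RO_icE px q /px[r rq [U [p' p'x <-]]]|px].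
  move=> /RO_icE/(_ _ (lexx r))[r' r'r r'p'].
  exists r'; first exact: le_trans rq.
  exact: colored_down p'x.
apply/RO_icE => q /px[r rq rx]; exists r => //.
exists (rho r); first by exists r.
exact: rho_self.
Qed.

Lemma colored_bcolor p x i : colored p x i ->
  (bcolor i x : set (lower (cond X))) p.
Proof.
by move=> px; apply/bcolorE => q qp; exists q => //; exact: colored_down px.
Qed.

Lemma bcolor_disjoint p x : (bcolor true x : set (lower (cond X))) p ->
  ~ (bcolor false x : set (lower (cond X))) p.
Proof.
move=> /bcolorE/(_ _ (lexx p))[q qp qx] /bcolorE/(_ _ qp)[r rq rx].
by have := colored_unique (colored_down rq qx) rx.
Qed.

(** If no extension colors [x] true, every extension can be extended to color it false. Both
    coordinates of [j] thus become instances of [bcolor]. *)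
Lemma compl_b_elt x : (~` b_elt x)%O = bcolor false x.
Proof.
apply/RO_inj/seteqP; split=> p.
  move=> /RO_complE px; apply/bcolorE => q qp; apply: color_extend => qx.
  by apply: px qp _; exact: colored_bcolor.
move=> px; apply/RO_complE => q qp qx; apply: bcolor_disjoint qx _.
exact: RO_down px.
Qed.

Lemma bcolor_tail s N n p i : (N <= n)%N ->
  (tail_value s N : set (lower (cond X))) p ->
  (bcolor i (val s n) : set (lower (cond X))) p <->
  (bcolor i (limit s) : set (lower (cond X))) p.
Proof.
move=> Nn /RO_icE pN; split=> /bcolorE px; apply/bcolorE => q qp;
  have [r rq [M MN sM]] := pN q qp; have [t tr tx] := px _ (le_trans rq qp);
  exists t; rewrite ?(le_trans tr)//; have /cond_leP[rt _] := tr;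
  by apply/(colored_tail _ (rt _ sM) (leq_trans MN Nn)).
Qed.

Lemma b_elt_inj : injective (@b_elt X).
Proof.
move=> x y xy; apply: contrapT => nxy.
(* With no sequences imposed, distinct points can be colored independently; this condition separates
   the two Boolean values. *)
pose p0 : precond X := (fset0, [fmap].[x <- true].[y <- false])%fmap.
have adm : admissible p0.
  apply: (@admissible_coloring _ (fun u => `[< u <> y >])) => [u i|s N n] /=.
    rewrite !fnd_set fnd_fmap0; case: eqP => [->[<-]|uy]; first exact/asboolF.
    by case: eqP => // _ [<-]; exact/asboolT.
  by rewrite in_fset0.
pose p := MkCond (asboolT adm).
have px : colored p x true.
  by apply: colored_eps; rewrite /= !fnd_set eqxx; case: eqP.
have py : colored p y false by apply: colored_eps; rewrite /= fnd_set eqxx.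
apply: (@bcolor_disjoint p y); last exact: colored_bcolor.
by move/colored_bcolor: px; rewrite -[bcolor true x]/(b_elt x) xy.
Qed.

(** * The map into the square and its behavior along sequences *)

Definition jval x : scott (BX X *p BX X) := (b_elt x, (~` b_elt x)%O).

(** Complementation reverses the order, so the second coordinate supplies the opposite
    inequality. *)
Lemma jval_le x y : (jval x <= jval y)%O -> x = y.
Proof.
move=> /andP[/= xy]; rewrite Order.CTBDistrLatticeTheory.leC => yx.
by apply: b_elt_inj; apply/le_anti/andP.
Qed.

Lemma bcolor_tail_sup s i : isLub
  (range (fun N => (bcolor i (limit s) `&` tail_value s N)%O : BX X))
  (bcolor i (limit s)).
Proof.
split=> [_ [N _ <-]|c cub]; first exact: leIl.
apply/RO_leP => p px; apply: RO_dense => q qp.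
have [N [r rq sN]] := sequence_extend q s; exists r => //.
have /RO_leP := cub _ (imageT _ N); apply.
split; last exact: tail_value_ge sN (leqnn N).
by apply: RO_down px; exact: le_trans qp.
Qed.

Lemma bcolor_tail_le s N n i : (N <= n)%N ->
  (bcolor i (limit s) `&` tail_value s N <= bcolor i (val s n) :> BX X)%O.
Proof.
by move=> Nn; apply/RO_leP => p [px pN]; apply/(bcolor_tail i Nn pN).
Qed.

Lemma limit_exist (s : nat -> X) x (sx : s @ \oo --> x) :
  exists2 t : convseq X, val t = s & limit t = x.
Proof.
have st : s \in [set s : nat -> X | exists x : X, s @ \oo --> x].
  by rewrite inE; exists x.
exists (exist _ s st) => //; apply: hX sx; exact: limit_cvg.
Qed.

Lemma jval_cvg (s : nat -> X) x : s @ \oo --> x ->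
  jval (s n) @[n --> \oo] --> jval x.
Proof.
move=> /limit_exist[t <- <-] A; rewrite nbhsE => -[V [Vop Vx] VA].
pose D : set (BX X *p BX X) := range (fun N =>
  ((bcolor true (limit t) `&` tail_value t N)%O,
   (bcolor false (limit t) `&` tail_value t N)%O)).
have Ddir : directed D.
  split; first by eexists; exists 0.
  move=> _ _ [M _ <-] [N _ <-]; eexists; split; first by exists (maxn M N).
    apply/andP; split; apply: leI2 => //;
      by apply: tail_value_le; exact: leq_maxl.
  apply/andP; split; apply: leI2 => //;
    by apply: tail_value_le; exact: leq_maxr.
have Dlub : isLub D (jval (limit t)).
  rewrite /jval compl_b_elt; split=> [_ [N _ <-]|[c1 c0] cub].
    by apply/andP; split; exact: leIl.
  apply/andP; split; apply: (bcolor_tail_sup t _).2 => _ [N _ <-];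
    by have /andP[] := cub _ (imageT _ N).
(* Scott openness puts one truncation into [V]; as [V] is an upper set, it also contains [jval] of
   all terms from [N] on. *)
have [_ [[N _ <-] VN]] := Vop.2 _ _ Ddir Dlub Vx.
exists N => // n /= Nn; apply: VA; apply: Vop.1 VN.
by rewrite /jval compl_b_elt; apply/andP; split; exact: bcolor_tail_le.
Qed.

Lemma jval_ge_lim (s : nat -> X) x d : s @ \oo --> x ->
  (forall n, (d <= jval (s n))%O) -> (d <= jval x)%O.
Proof.
move=> /limit_exist[t <- <-] dt.
have le_lim i (c : BX X) : (forall n, (c <= bcolor i (val t n))%O) ->
    (c <= bcolor i (limit t))%O.
  move=> ct; apply/RO_leP => p cp; apply: RO_dense => q qp.
  (* Below [r] the term at index [N] and the limit have the same color value, so the bound at that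
     single term passes to the limit. *)
  have [N [r rq tN]] := sequence_extend q t; exists r => //.
  apply/(bcolor_tail i (leqnn N) (tail_value_ge tN (leqnn N))).
  by have /RO_leP := ct N; apply; apply: RO_down cp; exact: le_trans qp.
rewrite /jval compl_b_elt; apply/andP; split; apply: le_lim => n;
  by have := dt n; rewrite /jval compl_b_elt => /andP[].
Qed.

(** * Injectivity, continuity and embedding *)

Lemma jmap_inj : injective (@jmap X).
Proof. by move=> x y /(congr1 (fun z => (val z).1)) /b_elt_inj. Qed.

Lemma jmap_cvg (s : nat -> X) x : s @ \oo --> x ->
  jmap (s n) @[n --> \oo] --> jmap x.
Proof.
move=> sx A; rewrite nbhsE => -[W [[V Vop <-] Vx] VA].
have : nbhs (jval x) V by exact: open_nbhs_nbhs (conj Vop Vx).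
by move=> /(jval_cvg sx)[N _ VN]; exists N => // n /VN;
  exact: (VA (jmap (s n))).
Qed.

Lemma jmap_continuous : sequential_space X -> continuous (@jmap X).
Proof.
move=> seqX; apply/continuousP => W Wop; rewrite -[_ @^-1` _]setCK openC.
apply/seqX => s x sW sx Wx.
have : nbhs (jmap x) W by exact: open_nbhs_nbhs (conj Wop Wx).
by move=> /(jmap_cvg sx)[N _ /(_ N (leqnn N))]; exact: sW.
Qed.

(* For [d] in a directed subset of the complement, the sets of points outside
   [U] with [d <= jval x] are closed and nonempty, and they decrease in [d]. *)
Lemma scott_open_compl_down (U : set X) :
  sequential_space X -> cover_compact [set: X] -> open U ->
  open [set z : scott (BX X *p BX X) | ~ exists2 a, ~ U a & (z <= jval a)%O].
Proof.
move=> seqX cptX Uop; split=> [y z yz nU [a Ua za]|D z Ddir Dz nU].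
  by apply: nU; exists a => //; exact: le_trans za.
apply: contrapT => DU.
have DU' d : D d -> exists2 a, ~ U a & (d <= jval a)%O.
  by move=> Dd; apply: contrapT => nd; apply: DU; exists d.
have [|x _|F FD cov] := cptX _ D
    (fun d => ~` [set a | ~ U a /\ (d <= jval a)%O]).
- move=> d Dd; rewrite openC; apply/seqX => s x sU sx; split.
    have /seqX UC : closed (~` U) by rewrite closedC.
    by apply: (UC s) => // n; have [] := sU n.
  by apply: jval_ge_lim sx _ => n; have [] := sU n.
(* An uncovered [x] would lie outside [U], as [D] is nonempty, and [jval x] would bound [D], hence
   also its supremum [z]. *)
- apply: contrapT => ncov; apply: nU; exists x.
    move=> Ux; have [d Dd] := Ddir.1; apply: ncov; exists d => //=.
    by case.
  apply: Dz.2 => d Dd; apply: contrapT => dx.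
  by apply: ncov; exists d => //= -[_ /dx].
(* A single [d] in [D] dominates the finite subcover, so the point [a] found for [d] escapes every
   member of it. *)
have [d Dd dF] := directed_fset Ddir FD.
have [a Ua da] := DU' d Dd.
have [e /= /dF ed] := cov a I; apply; split=> //.
exact: le_trans da.
Qed.

Lemma jmap_embedding : sequential_space X -> cover_compact [set: X] ->
  topological_embedding (@jmap X).
Proof.
move=> seqX cptX; split.
- exact: jmap_inj.
- exact: jmap_continuous.
move=> U Uop; exists (set_val @^-1`
    [set z : scott (BX X *p BX X) | ~ exists2 a, ~ U a & (z <= jval a)%O]).
  eexists; [exact: scott_open_compl_down seqX cptX Uop|by []].
apply/seteqP; split=> [_ [x Ux <-]|_ [[x _ <-] nx]].
  by split=> // -[a Ua /jval_le xa]; apply: Ua; rewrite -xa.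
exists x => //; apply: contrapT => Ux; apply: nx; exists x => //.
Qed.

End Coloring.

Theorem theorem4p12 (X : topologicalType) (hX : US_space X) :
  complete_lattice (BX X) /\
  (forall x : X, val (jmap x) = (b_elt x, (~` b_elt x)%O)) /\
  injective (@jmap X) /\
  (forall (s : nat -> X) (x : X), s @ \oo --> x ->
    (fun n => jmap (s n)) @ \oo --> jmap x) /\
  (sequential_space X -> continuous (@jmap X)) /\
  (sequential_space X -> cover_compact [set: X] ->
    topological_embedding (@jmap X)).
Proof.
split; first by move=> A; exists (RO_sup A); exact: RO_supP.
split; first by [].
split; first exact: jmap_inj.
split; first by move=> s x; exact: jmap_cvg.
by split; [exact: jmap_continuous|exact: jmap_embedding].
Qed.
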